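(* Let $\mathcal{G}$ be a 2-player finite game, let $y(t)$ solve $\dot y_k=v_k(Q(y))$, $k=1,2$, and let $x(t)=Q(y(t))$. Then the $\omega$-limit set of the time average $\bar x(t)=t^{-1}\int_0^tx(s)\,ds$ is internally chain transitive under the best response dynamics $\dot x_k\in\mathtt{br}_k(x)-x_k$, $k=1,2$.
   Context: Setting: finite game with players $\{1,2\}$, action sets $\mathcal{A}_k$, mixed strategies $\mathcal{X}_k=\Delta(\mathcal{A}_k)$, $\mathcal{X}=\mathcal{X}_1\times\mathcal{X}_2$, bilinear expected payoffs $u_k$, payoff vectors $v_k(x)=(u_k(\alpha;x_{-k}))_{\alpha\in\mathcal{A}_k}$. Each player has a penalty function $h_k$ on $\mathcal{X}_k$ (continuous, $C^\infty$ on relative interiors of faces, strongly convex: $h(tx_1+(1-t)x_2)\le th(x_1)+(1-t)h(x_2)-\tfrac12Kt(1-t)\|x_1-x_2\|^2$, $K>0$), with choice map $Q_k(y_k)=\arg\max_{x_k\in\mathcal{X}_k}\{\langle y_k,x_k\rangle-h_k(x_k)\}$. The best response correspondence is $\mathtt{br}_k(x)=\arg\max_{x_k'\in\mathcal{X}_k}\langle v_k(x),x_k'\rangle$. A compact set $L\subseteq\mathcal{X}$ is internally chain transitive for a differential inclusion if for all $x,z\in L$, $\varepsilon>0$, $T>0$ there exist $n\ge1$, solutions $z_1,\dots,z_n$ of the inclusion and times $t_1,\dots,t_n\ge T$ with $z_i([0,t_i])\subseteq L$, $\|z_i(t_i)-z_{i+1}(0)\|\le\varepsilon$ for $i<n$,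 $\|z_1(0)-x\|\le\varepsilon$ and $\|z_n(t_n)-z\|\le\varepsilon$. *)

(* Defs.v *)
From HB Require Import structures.
From mathcomp Require Import all_boot all_order all_algebra.
From mathcomp Require Import all_classical all_reals all_analysis.
Set Implicit Arguments. Unset Strict Implicit. Unset Printing Implicit Defensive.
Import Order.TTheory GRing.Theory Num.Theory.
Import numFieldNormedType.Exports.
Local Open Scope classical_set_scope.
Local Open Scope ring_scope.

Section Defs.
Variable R : realType.

Definition simplex (n : nat) : set 'rV[R]_n :=
  [set x | (forall i, 0 <= x 0 i) /\ \sum_i x 0 i = 1].

Definition dotp (n : nat) (y x : 'rV[R]_n) : R := \sum_i y 0 i * x 0 i.

(* Payoff vectors of a two-player game with payoff matrices U1 U2 : 'M_(n1,n2)
   (U_k a b = u_k(a,b) when player 1 plays a and player 2 plays b).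
   v_1(x)_a = u_1(a; x_2) = sum_b U1 a b x_2 b,
   v_2(x)_b = u_2(b; x_1) = sum_a U2 a b x_1 a. *)
Definition payv1 (n1 n2 : nat) (U1 : 'M[R]_(n1, n2)) (x : 'rV[R]_n1 * 'rV[R]_n2)
  : 'rV[R]_n1 := \row_a \sum_b U1 a b * x.2 0 b.
Definition payv2 (n1 n2 : nat) (U2 : 'M[R]_(n1, n2)) (x : 'rV[R]_n1 * 'rV[R]_n2)
  : 'rV[R]_n2 := \row_b \sum_a U2 a b * x.1 0 a.

Definition face_relint (n : nat) (S : {set 'I_n}) : set 'rV[R]_n :=
  [set x | (forall i, i \in S -> 0 < x 0 i) /\ (forall i, i \notin S -> x 0 i = 0)
           /\ \sum_i x 0 i = 1].
Definition face_tangent (n : nat) (S : {set 'I_n}) : set 'rV[R]_n :=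
  [set d | (forall i, i \notin S -> d 0 i = 0) /\ \sum_i d 0 i = 0].

Fixpoint iterD (n : nat) (h : 'rV[R]_n -> R) (ds : seq 'rV[R]_n) : 'rV[R]_n -> R :=
  match ds with
  | [::] => h
  | d :: ds' => fun x => 'D_d (iterD h ds') x
  end.

(* h is C^infty on the relative interior U of a face (an open subset of its
   affine hull, whose direction space is T): all iterated directional
   derivatives along T exist on U and are continuous on U. *)
Definition smooth_on (n : nat) (U T : set 'rV[R]_n) (h : 'rV[R]_n -> R) : Prop :=
  forall ds : seq 'rV[R]_n, (forall d, d \in ds -> T d) ->
    (forall d x, T d -> U x -> derivable (iterD h ds) x d) /\
    {within U, continuous (iterD h ds)}.

Definition penalty (n : nat) (h : 'rV[R]_n -> R) : Prop :=
  {within @simplex n, continuous h} /\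
  (forall S : {set 'I_n}, (0 < #|S|)%N -> smooth_on (face_relint S) (face_tangent S) h) /\
  (exists K : R, 0 < K /\
    forall x1 x2 (t : R), @simplex n x1 -> @simplex n x2 -> 0 <= t <= 1 ->
      h (t *: x1 + (1 - t) *: x2) <=
        t * h x1 + (1 - t) * h x2 - 2^-1 * K * t * (1 - t) * `|x1 - x2| ^+ 2).

Definition choice_map (n : nat) (h : 'rV[R]_n -> R) (Q : 'rV[R]_n -> 'rV[R]_n) : Prop :=
  forall y, @simplex n (Q y) /\
    forall x, @simplex n x -> dotp y x - h x <= dotp y (Q y) - h (Q y).

Definition br (n : nat) (v : 'rV[R]_n) : set 'rV[R]_n :=
  [set x' | @simplex n x' /\ forall x'', @simplex n x'' -> dotp v x'' <= dotp v x'].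

Definition abs_cont_on (V : normedModType R) (a b : R) (f : R -> V) : Prop :=
  forall e : R, 0 < e -> exists2 d : R, 0 < d &
    forall (m : nat) (s t : nat -> R),
      (forall k, (k < m)%N -> a <= s k /\ s k <= t k /\ t k <= b) ->
      (forall k, (k.+1 < m)%N -> t k <= s k.+1) ->
      \sum_(k < m) (t k - s k) < d ->
      \sum_(k < m) `|f (t k) - f (s k)| < e.

Definition br_solution (n1 n2 : nat) (U1 U2 : 'M[R]_(n1, n2)) (T : R)
    (z : R -> 'rV[R]_n1 * 'rV[R]_n2) : Prop :=
  abs_cont_on 0 T z /\
  {ae (@lebesgue_measure R), forall t, t \in `[0, T] ->
     derivable z t 1 /\
     (exists2 b1, br (payv1 U1 (z t)) b1 & ('D_1 z t).1 = b1 - (z t).1) /\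
     (exists2 b2, br (payv2 U2 (z t)) b2 & ('D_1 z t).2 = b2 - (z t).2)}.

Definition ICT_br (n1 n2 : nat) (U1 U2 : 'M[R]_(n1, n2))
    (L : set ('rV[R]_n1 * 'rV[R]_n2)) : Prop :=
  compact L /\ (forall p, L p -> @simplex n1 p.1 /\ @simplex n2 p.2) /\
  forall x z, L x -> L z -> forall eps T : R, 0 < eps -> 0 < T ->
    exists (m : nat) (zs : nat -> R -> 'rV[R]_n1 * 'rV[R]_n2) (ts : nat -> R),
      (0 < m)%N /\
      (forall i, (i < m)%N ->
         T <= ts i /\ br_solution U1 U2 (ts i) (zs i) /\
         (forall s, 0 <= s <= ts i -> L (zs i s))) /\
      (forall i, (i.+1 < m)%N -> `|zs i (ts i) - zs i.+1 0| <= eps) /\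
      `|zs 0%N 0 - x| <= eps /\
      `|zs m.-1 (ts m.-1) - z| <= eps.

Definition omega_limit (V : normedModType R) (f : R -> V) : set V :=
  [set p | forall (T e : R), 0 < e -> exists t, T <= t /\ `|f t - p| < e].

Definition time_avg (n : nat) (x : R -> 'rV[R]_n) (t : R) : 'rV[R]_n :=
  \row_i (t^-1 * \int[@lebesgue_measure R]_(s in `[0, t]) x s 0 i).

End Defs.

(* Main.v *)
Require Import Defs.
From HB Require Import structures.
From mathcomp Require Import all_boot all_order all_algebra.
From mathcomp Require Import all_classical all_reals all_analysis.
From mathcomp Require Import measurable_realfun lra ring.
Set Implicit Arguments. Unset Strict Implicit. Unset Printing Implicit Defensive.
Import Order.TTheory GRing.Theory Num.Theory.
Import numFieldNormedType.Exports.
Local Open Scope classical_set_scope.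
Local Open Scope ring_scope.

(* Along the trajectory, y_k(t) = y_k(0) + t v_k(xbar(t)), and x_k(t) maximizes
   <y_k(t), .> - h_k; dividing by t, x_k(t) is an O(1/t)-best response to
   xbar(t).  Put X(t) = int_0^t x = t xbar(t).  Then X is nondecreasing and
   1-Lipschitz in each coordinate, and on [a, b] its mean slope is an
   O(1/a + (b - a)/a)-best response to X(a)/a (the predicate near_br).  These
   properties are closed under pointwise limits of X(s t)/t as t -> +oo, and
   the 1/a error disappears in the limit F.  A monotone Lipschitz F is a.e.
   differentiable, and where it is, z(s) = e^-s F(e^s) satisfies the best
   response inclusion.  By compactness, for large t the curve s |-> xbar(e^s t)
   is uniformly close on [0, T] to such a solution lying in the limit set;
   concatenating these solutions gives the chains. *)

(** * Almost everywhere differentiability of monotone Lipschitz functions *)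

Lemma monotone_continuous1 {R : realType} (F : R -> R) :
  (forall a b, a <= b -> 0 <= F b - F a <= b - a) -> continuous F.
Proof.
move=> FL x; apply/cvgrPdist_le => e e0; near=> y.
have xy : `|x - y| <= e by near: y; apply: cvgr_dist_le.
apply: le_trans xy; have [xy|/ltW yx] := leP x y.
  have /andP[? ?] := FL _ _ xy.
  by rewrite distrC ger0_norm// distrC ger0_norm// subr_ge0.
have /andP[? ?] := FL _ _ yx.
by rewrite ger0_norm// ger0_norm// subr_ge0.
Unshelve. all: by end_near. Qed.

(** The function [x - F x] is nondecreasing too, so it has its own Stieltjes measure. The two
    measures add up to Lebesgue measure, by uniqueness from half-open intervals, and the second one
    is nonnegative. *)
Lemma lebesgue_stieltjes_le_lebesgue {R : realType} (F : cumulative R R) :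
  (forall a b, a <= b -> 0 <= F b - F a <= b - a) ->
  forall A : set (measurableTypeR R), measurable A ->
  (lebesgue_stieltjes_measure F A <= lebesgue_measure A)%E.
Proof.
move=> FL A mA.
pose Gf := fun x : R => x - F x.
have nd : nondecreasing Gf.
  move=> a b ab; have /andP[_] := FL _ _ ab; rewrite /Gf; lra.
have rc : right_continuous Gf.
  apply: right_continuousW => x; apply: cvgB; first exact: cvg_id.
  exact: monotone_continuous1.
pose G : cumulative R R := HB.pack Gf (isCumulative.Build R _ R Gf nd rc).
have mE (H : cumulative R R) a b : a <= b ->
    lebesgue_stieltjes_measure H `]a, b]%classic = (H b - H a)%:E.
  move=> ab; rewrite /lebesgue_stieltjes_measure /measure_extension.
  by rewrite measurable_mu_extE/=; [rewrite wlength_itv_bnd | exact: is_ocitv].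
pose lF : {measure set (measurableTypeR R) -> \bar R} := lebesgue_stieltjes_measure F.
pose lG : {measure set (measurableTypeR R) -> \bar R} := lebesgue_stieltjes_measure G.
rewrite (@lebesgue_measure_unique _ (measure_add lF lG))//.
  apply: (@le_trans _ _ (lF A + lG A)%E); last by rewrite -measure_addE.
  by rewrite leeDl.
move=> X /ocitvP[->|[[a b] /= /ltW ab ->]]; first by rewrite !measure0.
transitivity ((F b - F a)%:E + (G b - G a)%:E)%E.
  rewrite /lebesgue_measure mE//= -EFinD /Gf; congr EFin; ring.
by rewrite [RHS](measure_addE lF lG); congr (_ + _)%E; exact/esym/mE.
Qed.

(* The Stieltjes measure of F is dominated by Lebesgue measure, so F is the
   primitive of its Radon-Nikodym density and Lebesgue differentiation applies. *)
Lemma monotone_lipschitz1_ae_derivable {R : realType} (F : R -> R) (a b : R) :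
  (forall a b, a <= b -> 0 <= F b - F a <= b - a) ->
  {ae (@lebesgue_measure R), forall x, x \in `]a, b[ -> derivable F x 1}.
Proof.
move=> FL.
have nd : nondecreasing F.
  by move=> x y xy; have /andP[] := FL _ _ xy; rewrite subr_ge0.
have rc : right_continuous F.
  exact/right_continuousW/monotone_continuous1.
pose C : cumulative R R := HB.pack F (isCumulative.Build R _ R F nd rc).
pose D : set (measurableTypeR R) := `]a, b]%classic.
have mD : measurable D by exact: measurable_itv.
have moo : (lebesgue_stieltjes_measure C D < +oo)%E.
  have H := lebesgue_stieltjes_le_lebesgue (F := C) FL mD.
  apply: (@le_lt_trans _ _ (lebesgue_measure D)); first exact: H.
  by rewrite /D lebesgue_measure_itv/=; case: ifP; rewrite -?EFinB ltry.
(* Restricting to a bounded interval makes the measure finite before its density is taken. *)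
pose nu : {finite_measure set _ -> \bar R} := mfrestr mD moo.
have dom : nu `<< @lebesgue_measure R.
  apply/null_content_dominatesP => A mA A0.
  apply/eqP; rewrite eq_le measure_ge0 andbT.
  have mAD : measurable (A `&` D) by exact: measurableI.
  apply: (@le_trans _ _ (lebesgue_stieltjes_measure C (A `&` D))) => //.
  rewrite (le_trans (lebesgue_stieltjes_le_lebesgue (F := C) FL mAD))//.
  by rewrite -A0 le_measure ?inE//; exact: subIsetl.
pose g := Radon_Nikodym_SigmaFinite.f nu (@lebesgue_measure R).
have gE : (EFin \o (fine \o g)) = g.
  by apply/funext => x /=; rewrite fineK// Radon_Nikodym_SigmaFinite.f_fin_num.
have gi : (@lebesgue_measure R).-integrable setT (EFin \o (fine \o g)).
  by rewrite gE; exact: Radon_Nikodym_SigmaFinite.f_integrable.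
have FE x : x \in `]a, b[ ->
    F x = F a + \int[@lebesgue_measure R]_(t in `]a, x]) (fine \o g) t.
  rewrite in_itv/= => /andP[ax xb].
  have -> : \int[@lebesgue_measure R]_(t in `]a, x]) (fine \o g) t =
      fine (\int[@lebesgue_measure R]_(t in `]a, x]) g t)%E.
    by rewrite -[in RHS]gE.
  rewrite -Radon_Nikodym_SigmaFinite.f_integral//.
  rewrite /nu/= /mfrestr /mrestr /= /D.
  rewrite (_ : _ `&` _ = `]a, x]%classic); last first.
    apply/seteqP; split => t /=; rewrite !in_itv/=; first by case.
    by move=> /andP[-> tx]; rewrite tx (le_trans tx)// ltW.
  rewrite /lebesgue_stieltjes_measure /measure_extension.
  rewrite measurable_mu_extE/=; last exact: is_ocitv.
  by rewrite wlength_itv_bnd ?ltW//= subrKC.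
have locg : locally_integrable setT (fine \o g).
  by apply: open_integrable_locally => //; exact: openT.
have gI y : (@lebesgue_measure R).-integrable `]a, y] (EFin \o (fine \o g)).
  by apply: integrableS gi => //; exact: measurable_itv.
have := @FTC1 R (fine \o g) (BRight a) gI locg.
apply: filterS; first exact: (ae_filter_ringOfSetsType lebesgue_measure).
move=> x /= dx xab.
have /andP[ax xb] : a < x < b by move: xab; rewrite in_itv.
have [{}dx _] := dx ax.
have : derivable (fun y => F a +
    \int[@lebesgue_measure R]_(t in `]a, y]) (fine \o g) t) x 1.
  by apply: derivableD => //; exact: derivable_cst.
(* Differentiability is local: the primitive formula holds on []a, b[], which is a neighbourhood of
   [x]. *)
apply: near_eq_derivable; near=> y; apply/esym/FE.
rewrite in_itv/=; apply/andP; split; near: y.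
  exact: lt_nbhsr.
exact: lt_nbhsl.
Unshelve. all: by end_near. Qed.

(** * Choice maps *)

Lemma dotpE {R : realType} n (y x : 'rV[R]_n) : dotp y x = (y *m x^T) 0 0.
Proof. by rewrite /dotp mxE; apply: eq_bigr => i _; rewrite mxE. Qed.

Lemma dotpDl {R : realType} n (y z x : 'rV[R]_n) :
  dotp (y + z) x = dotp y x + dotp z x.
Proof. by rewrite !dotpE mulmxDl mxE. Qed.

Lemma dotpDr {R : realType} n (x y z : 'rV[R]_n) :
  dotp x (y + z) = dotp x y + dotp x z.
Proof. by rewrite !dotpE linearD/= mulmxDr mxE. Qed.

Lemma dotpNl {R : realType} n (y x : 'rV[R]_n) : dotp (- y) x = - dotp y x.
Proof. by rewrite !dotpE mulNmx mxE. Qed.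

Lemma dotpNr {R : realType} n (x y : 'rV[R]_n) : dotp x (- y) = - dotp x y.
Proof. by rewrite !dotpE linearN/= mulmxN mxE. Qed.

Lemma dotpZl {R : realType} n (a : R) (y x : 'rV[R]_n) :
  dotp (a *: y) x = a * dotp y x.
Proof. by rewrite !dotpE -scalemxAl mxE. Qed.

Lemma dotpZr {R : realType} n (a : R) (x y : 'rV[R]_n) :
  dotp x (a *: y) = a * dotp x y.
Proof. by rewrite !dotpE linearZ/= -scalemxAr mxE. Qed.

Lemma dotp_delta {R : realType} n (y : 'rV[R]_n) i : dotp y (delta_mx 0 i) = y 0 i.
Proof.
rewrite /dotp (bigD1 i)//= mxE !eqxx mulr1 big1 ?addr0// => j /negPf ji.
by rewrite mxE ji andbF mulr0.
Qed.

Lemma entry_le_norm {R : realType} n (x : 'rV[R]_n) i : `|x 0 i| <= `|x|.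
Proof.
rewrite [leRHS]mx_normrE.
exact: (@le_bigmax _ _ _ _ (fun ij => `|x ij.1 ij.2|) (0, i)).
Qed.

Lemma norm_le_entry {R : realType} n (x : 'rV[R]_n) c : 0 <= c ->
  (forall i, `|x 0 i| <= c) -> `|x| <= c.
Proof.
move=> c0 xc; rewrite [leLHS]mx_normrE; apply: bigmax_le => // -[i j] _ /=.
by rewrite ord1.
Qed.

Lemma dotp_le {R : realType} n (y x : 'rV[R]_n) : dotp y x <= n%:R * `|y| * `|x|.
Proof.
rewrite /dotp; apply: (@le_trans _ _ (\sum_(i < n) `|y| * `|x|)).
  apply: ler_sum => i _; apply: le_trans (ler_norm _) _.
  by rewrite normrM ler_pM ?entry_le_norm.
by rewrite sumr_const card_ord -[in leLHS]mulr_natl mulrA.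
Qed.

Lemma simplex_delta {R : realType} n (i : 'I_n) : @simplex R n (delta_mx 0 i).
Proof.
split=> [j|]; first by rewrite mxE ler0n.
transitivity (dotp (const_mx 1 : 'rV[R]_n) (delta_mx 0 i)).
  by apply: eq_bigr => j _; rewrite [in RHS]mxE mul1r.
by rewrite dotp_delta mxE.
Qed.

Lemma simplex_conv {R : realType} n (x y : 'rV[R]_n) (t : R) : 0 <= t <= 1 ->
  simplex x -> simplex y -> simplex (t *: x + (1 - t) *: y).
Proof.
move=> /andP[t0 t1] [x0 x1] [y0 y1]; split=> [i|].
  by rewrite !mxE addr_ge0// mulr_ge0// subr_ge0.
under eq_bigr do rewrite !mxE.
by rewrite big_split/= -!mulr_sumr x1 y1 !mulr1 subrKC.
Qed.

(** Both maximizers are compared with their midpoint. Adding the two optimality inequalities to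
    strong convexity at [2^-1] gives [K d^2 <= 2 n |y - y'| d] with [d = |Q y - Q y'|]. *)
Lemma choice_map_lipschitz {R : realType} n (h : 'rV[R]_n -> R) Q :
  penalty h -> choice_map h Q ->
  exists c, forall y y', `|Q y - Q y'| <= c * `|y - y'|.
Proof.
move=> [_ [_ [K [K0 hK]]]] hQ; exists (2 * n%:R / K) => y y'.
have [sx optx] := hQ y; have [sx' optx'] := hQ y'.
set x := Q y in sx optx *; set x' := Q y' in sx' optx' *.
have t12 : 0 <= (2^-1 : R) <= 1 by apply/andP; split; lra.
have sm := simplex_conv t12 sx sx'.
have := hK _ _ _ sx sx' t12.
have := optx _ sm; have := optx' _ sm.
rewrite !dotpDr !dotpZr; set m := h (_ + _); set d := `|x - x'|.
have d0 : 0 <= d by exact: normr_ge0.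
have : dotp (y - y') (x - x') <= n%:R * `|y - y'| * d by exact: dotp_le.
rewrite !dotpDl !dotpDr !dotpNl !dotpNr expr2 => H1 H2 H3 H4.
have H : K * d * d <= 2 * n%:R * `|y - y'| * d by lra.
have [->|dn0] := eqVneq d 0.
  by rewrite !mulr_ge0// invr_ge0 ltW.
rewrite mulrAC ler_pdivlMr// mulrC -(@ler_pM2r _ d)//.
by rewrite lt_neqAle eq_sym dn0.
Qed.

(** The loss of [Q y] against a vertex is at most a difference of penalties. This is bounded
    uniformly in [y], since [Q 0] minimizes [h] on the simplex and there are finitely many
    vertices. *)
Lemma choice_map_gap {R : realType} n (h : 'rV[R]_n -> R) Q : choice_map h Q ->
  exists2 C : R, 0 <= C & forall (y : 'rV[R]_n) i, y 0 i <= dotp y (Q y) + C.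
Proof.
move=> hQ; have [sQ0 Q0] := hQ 0.
exists (`|\sum_i `|h (delta_mx 0 i)| - h (Q 0)|) => // y i.
have [sy /(_ _ (simplex_delta i))] := hQ y; rewrite dotp_delta.
have := Q0 _ sy; rewrite -(scale0r (0 : 'rV[R]_n)) !dotpZl !mul0r scale0r.
set S := \sum_i _; have : h (delta_mx 0 i) <= S.
  rewrite /S (bigD1 i)//=; apply: le_trans (ler_norm _) _.
  by rewrite lerDl sumr_ge0.
have := ler_norm (S - h (Q 0)); lra.
Qed.

(** * Cumulative play *)

Lemma unit_valued_integrable {R : realType} (f : R -> R) (t : R) :
  (forall s, 0 <= f s <= 1) -> (forall s : R, 0 < s -> {for s, continuous f}) ->
  (@lebesgue_measure R).-integrable `[0, t] (EFin \o f).
Proof.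
move=> f01 fc; have mf : measurable_fun `[0, t] f.
  (* The endpoint 0, where [f] may be discontinuous, is dropped; continuity on the open half-line
     then gives measurability. *)
  apply/measurable_fun_itv_obnd_cbndP.
  have mf : measurable_fun (`]0, +oo[%classic : set R) f.
    apply: open_continuous_measurable_fun; first exact: interval_open.
    by move=> s; rewrite inE/= in_itv/= andbT; exact: fc.
  apply: measurable_funS mf => //.
  by move=> s /=; rewrite !in_itv/= andbT => /andP[].
apply: measurable_bounded_integrable => //=.
  by rewrite lebesgue_measure_itv/=; case: ifP; rewrite -?EFinB ltry.
exists 1; split=> // x x1 s _ /=; have /andP[f0 f1] := f01 s.
by rewrite ger0_norm// (le_trans f1)// ltW.
Qed.

(** The interval [[0, t]] is empty for [t < 0], so [X] extends by 0 and the increment bounds hold on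
    the whole line; this yields continuity at 0 later. *)
Lemma primitive_monotone {R : realType} (f : R -> R) :
  (forall s, 0 <= f s <= 1) -> (forall s : R, 0 < s -> {for s, continuous f}) ->
  let X t := \int[@lebesgue_measure R]_(s in `[0, t]) f s in
  [/\ forall t : R, t <= 0 -> X t = 0,
      forall a b : R, a <= b -> 0 <= X b - X a <= b - a
    & forall t : R, 0 < t -> is_derive t 1 X (f t)].
Proof.
move=> f01 fc X; have fi t := @unit_valued_integrable R f t f01 fc.
have X0 t : t <= 0 -> X t = 0.
  rewrite le_eqVlt => /predU1P[->|t0].
    by rewrite /X set_itv1 Rintegral_set1.
  by rewrite /X set_itv_ge ?Rintegral_set0// bnd_simp -ltNge.
have X1 a b : 0 <= a -> a <= b -> 0 <= X b - X a <= b - a.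
  move=> a0 ab; rewrite /X Rintegral_itvB ?bnd_simp//.
  have fab : (@lebesgue_measure R).-integrable `]a, b] (EFin \o f).
    apply: integrableS (fi b) => //; apply: subset_itvr.
    by rewrite bnd_simp.
  rewrite Rintegral_ge0 => [|s _]; last by have /andP[] := f01 s.
  apply: (@le_trans _ _ (\int[@lebesgue_measure R]_(s in `]a, b]) 1)).
    apply: le_Rintegral => //=; last by move=> s _; have /andP[] := f01 s.
    apply: measurable_bounded_integrable => //=.
      by rewrite lebesgue_measure_itv/=; case: ifP; rewrite -?EFinB ltry.
    by exists 1; split=> // x x1 s _ /=; rewrite normr1 ltW.
  rewrite Rintegral_cst//= lebesgue_measure_itv/= mul1r lte_fin.
  by case: ltP => /=; rewrite ?subr_ge0//.
split=> // [a b ab|t t0].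
- have [b0|b0] := leP b 0.
    by rewrite !X0 ?(le_trans ab)// subrr lexx subr_ge0.
  have [a0|a0] := leP 0 a; first exact: X1.
  have /andP[h1 h2] := X1 _ _ (lexx 0) (ltW b0).
  move: h1 h2; rewrite (X0 0)// (X0 a) ?(ltW a0)// !subr0 => -> /= h2.
  by rewrite (le_trans h2)// lerDl oppr_ge0 ltW.
(* The upper end [t + 1] makes [t] an interior point, so the derivative is two-sided. *)
- have [dX <-] := @continuous_FTC1_closed R f 0 t (t + 1) (ltr_pwDr ltr01 (lexx t))
    (fi _) t0 (fc _ t0).
  by rewrite derive1E; apply/derivableP.
Qed.

(* The axiomatics of X t = \int_0^t x with x valued in the simplex. *)
Definition cumulative_play {R : realType} n (X : R -> 'rV[R]_n) :=
  [/\ forall t : R, t <= 0 -> X t = 0,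
      forall i (a b : R), a <= b -> X a 0 i <= X b 0 i
    & forall t : R, 0 <= t -> \sum_i X t 0 i = t].

(** For nonnegative times the coordinate increments are nonnegative and add up to [b - a], so each
    is at most [b - a]; negative times contribute nothing. *)
Lemma cumulative_play_incr {R : realType} n (X : R -> 'rV[R]_n) :
  cumulative_play X ->
  forall i (a b : R), a <= b -> 0 <= X b 0 i - X a 0 i <= b - a.
Proof.
move=> [X0 Xn Xs].
have main i a b : 0 <= a -> a <= b -> 0 <= X b 0 i - X a 0 i <= b - a.
  move=> a0 ab; rewrite subr_ge0 Xn//=.
  rewrite -[in leRHS](Xs a)// -[in leRHS](Xs b) ?(le_trans a0)// -sumrB.
  rewrite (bigD1 i)//= lerDl sumr_ge0// => j _.
  by rewrite subr_ge0 Xn.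
move=> i a b ab; have [|/ltW a0] := leP 0 a; first by move=> ?; exact: main.
have [b0|/ltW b0] := leP b 0; first by rewrite !X0// !mxE subrr lexx subr_ge0.
have := main i 0 b (lexx _) b0; rewrite (X0 0)// (X0 a)// !mxE !subr0.
by move=> /andP[-> /= h]; rewrite (le_trans h)// lerDl oppr_ge0.
Qed.

(** The mean value theorem makes [g] constant on positive times only; the right limit at 0 then
    identifies the constant. *)
Lemma derive0_cst_right {R : realType} (g : R -> R) (c : R) :
  (forall t : R, 0 < t -> is_derive t 1 g 0) -> g @ 0^'+ --> c ->
  forall t : R, 0 < t -> g t = c.
Proof.
move=> g' gc t t0.
have gE s : 0 < s -> g s = g t.
  wlog : s t t0 / s < t => [hw s0|st s0].
    by have [/hw->//|/hw->//|->] := ltgtP s t.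
  have [] := @MVT R g (fun=> 0) s t st.
  - move=> x; rewrite in_itv/= => /andP[sx _]; apply: g'; exact: lt_trans sx.
  - apply: derivable_within_continuous => x; rewrite in_itv/= => /andP[sx _].
    by apply: ex_derive; apply: g'; exact: lt_le_trans sx.
  by move=> x _ /eqP; rewrite mul0r subr_eq0 => /eqP.
have : g @ 0^'+ --> g t.
  apply: cvg_near_cst; near=> s; apply: gE; near: s; exact: nbhs_right_gt.
move=> gt; exact: (cvg_unique _ gt gc).
Unshelve. all: by end_near. Qed.

Lemma is_derive_mxE {R : realType} m n (y : R -> 'M[R]_(m, n)) (t : R) d i j :
  is_derive t 1 y d -> is_derive t 1 (fun s => y s i j) (d i j).
Proof.
move=> yd; have dy := @ex_derive _ _ _ _ _ _ _ yd.
apply: DeriveDef; first by move/derivable_mxP : dy; exact.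
by have <- := @derive_val _ _ _ _ _ _ _ yd; rewrite derive_mx// mxE.
Qed.

Lemma is_derive_sumr {R : realType} n (f : 'I_n -> R -> R) (t : R) (d : 'I_n -> R) :
  (forall j, is_derive t 1 (f j) (d j)) ->
  is_derive t 1 (fun s => \sum_j f j s) (\sum_j d j).
Proof.
move=> fd; rewrite (_ : (fun s => _) = \sum_j f j); first exact: is_derive_sum.
by apply/funext => s; rewrite fct_sumE.
Qed.

Lemma cvg_sumr {R : realType} {T : Type} (F : set_system T) {FF : Filter F} n
    (f : 'I_n -> T -> R) (l : 'I_n -> R) :
  (forall j, f j x @[x --> F] --> l j) ->
  \sum_j f j x @[x --> F] --> \sum_j l j.
Proof. by move=> fl; apply: cvg_big => //; exact: add_continuous. Qed.

Lemma cumulative_play_cvg0 {R : realType} n (X : R -> 'rV[R]_n) i :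
  cumulative_play X -> X t 0 i @[t --> 0^'+] --> 0.
Proof.
move=> Xp; apply: cvg_at_right_filter.
have X00 : X 0 0 i = 0 by have [X0 _ _] := Xp; rewrite X0// mxE.
rewrite -[Z in _ --> Z]X00; apply: monotone_continuous1.
exact: cumulative_play_incr.
Qed.

(** The dynamics are linear in the opponent's play, so [y - Y A] has zero derivative at positive
    times, and it tends to [y 0] at [0^'+]. *)
Lemma payoff_primitive {R : realType} m n (A : 'M[R]_(m, n)) (x Y : R -> 'rV[R]_m)
    (y : R -> 'rV[R]_n) :
  cumulative_play Y ->
  (forall j (t : R), 0 < t -> is_derive t 1 (fun s => Y s 0 j) (x t 0 j)) ->
  (forall t : R, 0 < t -> is_derive t 1 y (x t *m A)) -> y @ 0^'+ --> y 0 ->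
  forall t : R, 0 < t -> y t = y 0 + Y t *m A.
Proof.
move=> Yp Y' y' yc t t0; apply/rowP => i; rewrite !mxE.
suff H : y t 0 i - \sum_j Y t 0 j * A j i = y 0 0 i by rewrite -H subrK.
apply: (@derive0_cst_right _ (fun t => y t 0 i - \sum_j Y t 0 j * A j i)) => //.
(* The target derivative 0 is rewritten as a difference [S - S], the form produced by
   differentiating a difference. *)
- move=> s s0; have /esym := subrr (\sum_j x s 0 j * A j i); set S := \sum_j _ => S0.
  rewrite [X in is_derive _ _ _ X]S0 {S0}/S.
  apply: is_deriveB.
    by have := is_derive_mxE 0 i (y' _ s0); rewrite mxE.
  apply: is_derive_sumr => j.
  rewrite (_ : (fun _ => _) = A j i \*: (fun s => Y s 0 j)); last first.
    by apply/funext => u /=; rewrite mulrC.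
  rewrite mulrC; apply: is_deriveZ; exact: Y'.
- rewrite -[y 0 0 i]subr0; apply: cvgB.
    exact: (cvg_comp _ _ yc (@coord_continuous _ _ _ 0 i (y 0))).
  have : \sum_j Y t 0 j * A j i @[t --> 0^'+] --> \sum_(j < m) 0 * A j i.
    by apply: cvg_sumr => j; apply: cvgMr_tmp; exact: cumulative_play_cvg0.
  by under [X in _ --> X -> _]eq_bigr do rewrite mul0r; rewrite big1_eq.
Qed.

(* The average play (X b - X a) / (b - a) is a best response, up to
   C / a + D (b - a) / a, to the payoff vector induced by the opponent's
   time average Y a / a; A is the payoff matrix seen from the opponent. *)
Definition near_br {R : realType} m n (A : 'M[R]_(m, n)) (Y : R -> 'rV[R]_m)
    (X : R -> 'rV[R]_n) (C D : R) :=
  forall i (a b : R), 0 < a -> a <= b ->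
  (b - a) * ((a^-1 *: Y a) *m A) 0 i <=
    dotp ((a^-1 *: Y a) *m A) (X b - X a) +
    (b - a) * (C / a + D * ((b - a) / a)).

Lemma simplex_dotp_le {R : realType} n (w x : 'rV[R]_n) :
  simplex x -> dotp w x <= `|w|.
Proof.
move=> [x0 x1]; rewrite -[leRHS]mulr1 -x1 mulr_sumr; apply: ler_sum => i _.
by rewrite ler_wpM2r// (le_trans (ler_norm _))// entry_le_norm.
Qed.

Lemma norm_mulmx_le {R : realType} m n (A : 'M[R]_(m, n)) :
  exists2 B : R, 0 <= B & forall p : 'rV[R]_m, `|p *m A| <= B * `|p|.
Proof.
exists (\sum_j \sum_i `|A j i|).
  by rewrite sumr_ge0// => j _; rewrite sumr_ge0.
move=> p; apply: norm_le_entry => [|i].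
  by rewrite mulr_ge0// sumr_ge0// => j _; rewrite sumr_ge0.
rewrite mxE (le_trans (ler_norm_sum _ _ _))// mulr_suml ler_sum// => j _.
rewrite normrM mulrC ler_pM ?entry_le_norm//.
by rewrite (bigD1 i)//= lerDl sumr_ge0.
Qed.

(** Coordinatewise the difference is [(p (s - a) / a - (q - p)) / s]. Both terms of the numerator
    lie in [[0, s - a]], because [0 <= p <= a] and [q - p] is an increment. *)
Lemma average_lipschitz {R : realType} m (Y : R -> 'rV[R]_m) (a s : R) :
  cumulative_play Y -> 0 < a -> a <= s ->
  `|a^-1 *: Y a - s^-1 *: Y s| <= (s - a) / a.
Proof.
move=> Yp a0 as_; have s0 : 0 < s by exact: lt_le_trans as_.
apply: norm_le_entry => [|i]; first by rewrite divr_ge0 ?subr_ge0// ltW.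
have := cumulative_play_incr Yp i as_; have := cumulative_play_incr Yp i (ltW a0).
have [Y0 _ _] := Yp; rewrite (Y0 0 (lexx _)) !mxE !subr0.
set p := Y a 0 i; set q := Y s 0 i => /andP[p0 pa] /andP[pq qp].
have -> : a^-1 * p - s^-1 * q = (p * (s - a) / a - (q - p)) / s.
  by field; rewrite !gt_eqF.
rewrite normrM [`|s^-1|]gtr0_norm ?invr_gt0// ler_pdivrMr//.
have h1 : 0 <= p * (s - a) / a <= s - a.
  rewrite divr_ge0 ?mulr_ge0 ?subr_ge0 ?(ltW a0)//= ler_pdivrMr// mulrC.
  by rewrite ler_wpM2l ?subr_ge0.
have h2 : s - a <= (s - a) / a * s.
  by rewrite mulrAC ler_pdivlMr// ler_wpM2l ?subr_ge0.
move/andP : h1 => [h1 h1']; rewrite ler_norml; apply/andP; split; lra.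
Qed.

(** Dividing the gap of [x t] against [y t] by [t] makes [x t] an [O(1/t)]-best response to the
    current average. Freezing the payoff vector at time [a] costs [O((b - a) / a)], and the mean
    value theorem passes from [x] to the increment of [X]. *)
Lemma near_br_play {R : realType} m n (A : 'M[R]_(m, n)) (Y : R -> 'rV[R]_m)
    (X x y : R -> 'rV[R]_n) (C0 : R) :
  cumulative_play Y -> (forall t, simplex (x t)) ->
  (forall j (t : R), 0 < t -> is_derive t 1 (fun s => X s 0 j) (x t 0 j)) ->
  (forall t : R, 0 < t -> y t = y 0 + Y t *m A) ->
  0 <= C0 -> (forall t i, y t 0 i <= dotp (y t) (x t) + C0) ->
  exists2 C : R, 0 <= C & near_br A Y X C C.
Proof.
move=> Yp sx X' yE C00 gap; have [B B0 AB] := norm_mulmx_le A.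
have gapv i (t : R) : 0 < t ->
    ((t^-1 *: Y t) *m A) 0 i - dotp ((t^-1 *: Y t) *m A) (x t) <= (C0 + 2 * `|y 0|) / t.
  move=> t0; rewrite ler_pdivlMr//.
  have -> : t^-1 *: Y t *m A = t^-1 *: (y t - y 0).
    by rewrite yE// addrAC subrr add0r scalemxAl.
  rewrite dotpZl mxE -mulrBr mulrAC mulVf ?gt_eqF// mul1r.
  have h1 := gap t i; have h2 : dotp (y 0) (x t) <= `|y 0| by exact: simplex_dotp_le.
  have := entry_le_norm (y 0) i; rewrite ler_norml => /andP[h3 _].
  rewrite dotpDl dotpNl !mxE; lra.
(* The three terms pay for the gap, for the initial score [y 0], and for replacing the payoff vector
   at time [s] by the one at time [a]. *)
exists (C0 + 2 * `|y 0| + 2 * B); first by rewrite !addr_ge0// mulr_ge0.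
set C := _ + 2 * B; move=> i a b a0; set v := _ *m A; rewrite le_eqVlt => /predU1P[<-|ab].
  by rewrite !subrr !mul0r dotpE linear0 mulmx0 mxE addr0.
set k := C / a + _.
(* The increment of [phi] over [[a, b]] is the right side minus the left side of the required
   inequality. *)
pose phi s := \sum_j v 0 j * X s 0 j + s * (k - v 0 i).
have dphi (s : R) : 0 < s -> is_derive s 1 phi (dotp v (x s) + (k - v 0 i)).
  move=> s0; apply: is_deriveD.
    apply: is_derive_sumr => j; apply: (@is_deriveZ _ _ _ (fun s => X s 0 j)).
    exact: X'.
  rewrite -[X in is_derive _ _ _ X]mulr1 (_ : (fun _ => _) = (k - v 0 i) \*: id).
    by apply: is_deriveZ; exact: is_derive_id.
  by apply/funext => u /=; rewrite mulrC.
have [s||s] := @MVT R phi (fun s => dotp v (x s) + (k - v 0 i)) a b ab.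
- by rewrite in_itv/= => /andP[as_ _]; apply: dphi; exact: lt_trans as_.
- apply: derivable_within_continuous => s; rewrite in_itv/= => /andP[as_ _].
  by apply: ex_derive; apply: dphi; exact: lt_le_trans as_.
rewrite in_itv/= => /andP[as_ sb].
rewrite /phi => E; suff H : 0 <= (dotp v (x s) + (k - v 0 i)) * (b - a).
  rewrite dotpDr dotpNr /dotp; move: E H; lra.
rewrite mulr_ge0 ?subr_ge0 ?(ltW ab)//.
have s0 : 0 < s by exact: lt_trans as_.
have := gapv i s s0; set vs := _ *m A => g1.
have vvs : `|v - vs| <= B * ((b - a) / a).
  rewrite /v /vs -mulmxBl (le_trans (AB _))// ler_wpM2l//.
  rewrite (le_trans (average_lipschitz Yp a0 (ltW as_)))//.
  by rewrite ler_pM2r ?invr_gt0// lerD2r ltW.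
have g2 : dotp (vs - v) (x s) <= `|v - vs| by rewrite distrC; exact: simplex_dotp_le.
have := entry_le_norm (v - vs) i; rewrite ler_norml => /andP[_ g3].
have g4 : (C0 + 2 * `|y 0|) / s <= C / a.
  rewrite ler_pM ?invr_ge0 ?(ltW s0)//.
  - by rewrite addr_ge0// mulr_ge0.
  - by rewrite lerDl mulr_ge0.
  - by rewrite lef_pV2 ?posrE// ltW.
have g5 : 2 * B * ((b - a) / a) <= C * ((b - a) / a).
  rewrite ler_wpM2r ?divr_ge0 ?subr_ge0 ?(ltW ab) ?(ltW a0)// lerDr.
  by rewrite addr_ge0// mulr_ge0.
move: g2 g3; rewrite dotpDl dotpNl /k.
have -> : (v - vs) 0 i = v 0 i - vs 0 i by rewrite !mxE.
lra.
Qed.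

(** * Blow-down at infinity *)

Lemma ultra_bounded_cvg {R : realType} {T : Type} (U : set_system T)
    (f : T -> R) (a b : R) : UltraFilter U ->
  (\forall t \near U, a <= f t <= b) -> exists l : R, f x @[x --> U] --> l.
Proof.
move=> UU fab; have PU := @ultra_proper _ _ UU.
have fU : (f @ U) `[a, b]%classic.
  by apply: filterS fab => t ft; rewrite /= in_itv.
have [l [_ fl]] := @segment_compact R a b (f @ U) _ fU; exists l => B lB.
have [//|UnB] := in_ultra_setVsetC (f @^-1` B) UU.
by have [y [nBy By]] := fl (~` B) B UnB lB.
Qed.

(* Along an ultrafilter every bounded function converges, so one limit F is
   defined at all s simultaneously, without a diagonal extraction. *)
Lemma cumulative_play_blowdown {R : realType} n (X : R -> 'rV[R]_n)
    (U : set_system R) : UltraFilter U -> pinfty_nbhs R `<=` U ->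
  cumulative_play X -> exists2 F : R -> 'rV[R]_n, cumulative_play F &
    forall s i, t^-1 * X (s * t) 0 i @[t --> U] --> F s 0 i.
Proof.
move=> UU Uoo Xp; have PU := @ultra_proper _ _ UU.
have Xinc := cumulative_play_incr Xp; have [X0 Xn Xs] := Xp.
have U0 : \forall t \near U, 0 < t by apply: Uoo; exact: nbhs_pinfty_gt.
have XU s i : exists l : R, t^-1 * X (s * t) 0 i @[t --> U] --> l.
  apply: (@ultra_bounded_cvg _ _ _ _ 0 `|s|) => //.
  apply: filterS U0 => t t0; have [s0|s0] := leP s 0.
    by rewrite X0 ?mxE ?mulr0 ?lexx//= mulr_le0_ge0// ltW.
  have st0 : 0 <= s * t by rewrite mulr_ge0 ?ltW.
  have := Xinc i 0 (s * t) st0; rewrite (X0 0 (lexx _)) mxE !subr0 => /andP[h1 h2].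
  rewrite mulr_ge0 ?invr_ge0 ?(ltW t0)//= mulrC ler_pdivrMr// (le_trans h2)//.
  by rewrite ler_pM2r// ler_norm.
pose F s := \row_i sval (cid (XU s i)).
have FE s i : t^-1 * X (s * t) 0 i @[t --> U] --> F s 0 i.
  by rewrite /F mxE; case: cid.
exists F => //; split.
- move=> s s0; apply/rowP => i; rewrite [RHS]mxE.
  apply: (cvg_unique _ (FE s i)) => //; apply: cvg_near_cst.
  apply: filterS U0 => t t0.
  by rewrite X0 ?mxE ?mulr0// mulr_le0_ge0// ltW.
- move=> i a b ab; apply: ler_cvg_to (FE a i) (FE b i) _.
  apply: filterS U0 => t t0; rewrite ler_pM2l ?invr_gt0// Xn//.
  by rewrite ler_pM2r.
- move=> s s0; have : \sum_i t^-1 * X (s * t) 0 i @[t --> U] --> \sum_i F s 0 i.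
    by apply: cvg_sumr => i; exact: FE.
  move=> h; apply: (cvg_unique _ h) => //; apply: cvg_near_cst.
  apply: filterS U0 => t t0; rewrite -mulr_sumr Xs ?mulr_ge0 ?(ltW t0)//.
  by rewrite mulrC mulfK ?gt_eqF.
Qed.

(** Under the rescaling [X (s t) / t] the term [D (b - a) / a] is invariant, while [C / a] becomes
    [C / (a t)] and vanishes in the limit. *)
Lemma near_br_blowdown {R : realType} m n (A : 'M[R]_(m, n)) (Y G : R -> 'rV[R]_m)
    (X F : R -> 'rV[R]_n) (C D : R) (U : set_system R) :
  UltraFilter U -> pinfty_nbhs R `<=` U ->
  (forall s i, t^-1 * X (s * t) 0 i @[t --> U] --> F s 0 i) ->
  (forall s i, t^-1 * Y (s * t) 0 i @[t --> U] --> G s 0 i) ->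
  near_br A Y X C D -> near_br A G F 0 D.
Proof.
move=> UU Uoo XF YG br_XY i a b a0 ab; have PU := @ultra_proper _ _ UU.
have U0 : \forall t \near U, 0 < t by apply: Uoo; exact: nbhs_pinfty_gt.
pose W t := (a * t)^-1 *: Y (a * t) *m A.
have Wc j : W t 0 j @[t --> U] --> (a^-1 *: G a *m A) 0 j.
  have -> : (a^-1 *: G a *m A) 0 j = \sum_k a^-1 * G a 0 k * A k j.
    by rewrite mxE; apply: eq_bigr => k _; rewrite mxE.
  have -> : (fun t => W t 0 j) =
      (fun t => \sum_k a^-1 * (t^-1 * Y (a * t) 0 k) * A k j).
    apply/funext => t; rewrite /W mxE; apply: eq_bigr => k _.
    by rewrite mxE invfM !mulrA.
  apply: cvg_sumr => k; apply: cvgMr_tmp; apply: cvgMl_tmp; exact: YG.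
have Uinv : t^-1 @[t --> U] --> (0 : R).
  apply/cvgr0Pnorm_le => e e0.
  have Ue : \forall t \near U, e^-1 <= t.
    by apply: Uoo; apply: nbhs_pinfty_ge; exact: num_real.
  apply: filterS2 U0 Ue => t t0 et.
  by rewrite gtr0_norm ?invr_gt0// invf_ple ?posrE.
have L : (b - a) * W t 0 i @[t --> U] --> (b - a) * (a^-1 *: G a *m A) 0 i.
  exact: cvgMl_tmp.
have M : \sum_j W t 0 j * (t^-1 * X (b * t) 0 j - t^-1 * X (a * t) 0 j)
    + (b - a) * (C / a * t^-1 + D * ((b - a) / a)) @[t --> U] -->
    \sum_j (a^-1 *: G a *m A) 0 j * (F b 0 j - F a 0 j)
    + (b - a) * (C / a * 0 + D * ((b - a) / a)).
  apply: cvgD; first by apply: cvg_sumr => j; apply: cvgM => //; apply: cvgB.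
  apply: cvgMl_tmp; apply: cvgD; last exact: cvg_cst.
  exact: cvgMl_tmp.
(* The vanished error is written [0 / a] to match [near_br] with first constant 0. *)
move: M; rewrite mulr0 -[X in X + D * _](mul0r a^-1).
rewrite (_ : \sum_j (a^-1 *: G a *m A) 0 j * (F b 0 j - F a 0 j) =
  dotp (a^-1 *: G a *m A) (F b - F a)); last first.
  by apply: eq_bigr => j _; rewrite !mxE.
move=> M; apply: ler_cvg_to L M _; apply: filterS U0 => t t0.
have at0 : 0 < a * t by rewrite mulr_gt0.
have atb : a * t <= b * t by rewrite ler_pM2r.
have := br_XY i _ _ at0 atb; rewrite -/(W t) -mulrBl => H.
rewrite -(ler_pM2l t0) mulrDr mulr_sumr.
have -> : \sum_j t * (W t 0 j * (t^-1 * X (b * t) 0 j - t^-1 * X (a * t) 0 j)) =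
    dotp (W t) (X (b * t) - X (a * t)).
  apply: eq_bigr => j _; rewrite !mxE -mulrBr mulrCA [t * (_ * _)]mulrA.
  by rewrite divff ?gt_eqF// mul1r.
apply: (le_trans (le_trans _ H)); first by rewrite mulrA (mulrC t).
rewrite lerD2l le_eqVlt; apply/orP; left; apply/eqP.
by field; rewrite !gt_eqF.
Qed.

(** * Best response solutions in logarithmic time *)

Lemma filter_forall_ord {T : Type} (F : set_system T) {FF : Filter F} n
    (P : 'I_n -> T -> Prop) :
  (forall i, \forall x \near F, P i x) -> \forall x \near F, forall i, P i x.
Proof.
move=> FP; have H (s : seq 'I_n) : \forall x \near F, forall i, i \in s -> P i x.
  elim: s => [|i s IH]; first exact: filterE.
  apply: filterS2 (FP i) IH => x Pi Ps j.
  by rewrite inE => /predU1P[->//|]; exact: Ps.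
by apply: filterS (H (enum 'I_n)) => x Px i; apply: Px; rewrite mem_enum.
Qed.

(** Right difference quotients are nonnegative and have the same limit, so a minimum over the times
    [s >= t] is enough. *)
Lemma derive_ge0_right {R : realType} (f : R -> R) (t d : R) :
  is_derive t 1 f d -> (forall s, t <= s -> f t <= f s) -> 0 <= d.
Proof.
move=> fd ft; have dft := @ex_derive _ _ _ _ _ _ _ fd.
have fE := @derive_val _ _ _ _ _ _ _ fd.
have h0 : h^-1 *: ((f \o shift t) (h *: 1) - f t) @[h --> 0^'] --> d.
  by rewrite -fE; exact: dft.
have : h^-1 *: ((f \o shift t) (h *: 1) - f t) @[h --> 0^'+] --> d.
  exact: cvg_dnbhs_at_right.
move=> /cvgr_to_ge; apply; near=> h.
have hp : 0 < h by near: h; exact: nbhs_right_gt.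
rewrite /= mulr_ge0 ?invr_ge0 ?(ltW hp)// subr_ge0 ft//.
by rewrite lerDr [h *: 1]mulr1 ltW.
Unshelve. all: by end_near. Qed.

Lemma expR_increment_le {R : realType} (a b T : R) : a <= b -> b <= T ->
  0 <= expR b - expR a <= expR T * (b - a).
Proof.
move=> ab bT; rewrite subr_ge0 ler_expR ab/=.
have -> : expR b - expR a = expR b * (1 - expR (a - b)).
  by rewrite mulrBr mulr1 -expRD subrKC.
apply: (@le_trans _ _ (expR b * (b - a))).
  rewrite ler_wpM2l ?expR_ge0//.
  have := expR_ge1Dx (a - b); lra.
by rewrite ler_wpM2r ?subr_ge0// ler_expR.
Qed.

(** Treating the composite directly avoids transporting null sets through [expR]. Cutting time off
    at [T + 1] and dividing by [expR (T + 1)] makes each coordinate monotone and 1-Lipschitz on the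
    line. The interval []-1, T + 1[] contains [[0, T]] in its interior, and the cut-off is inactive
    there. *)
Lemma log_time_ae_derivable {R : realType} n (F : R -> 'rV[R]_n) (T : R) :
  cumulative_play F ->
  {ae (@lebesgue_measure R), forall t, t \in `[0, T] ->
    derivable (fun s => F (expR s)) t 1}.
Proof.
move=> Fp; have Finc := cumulative_play_incr Fp.
pose c (s : R) := Num.min s (T + 1).
pose G i s := (expR (T + 1))^-1 * F (expR (c s)) 0 i.
have cinc a b : a <= b -> 0 <= c b - c a <= b - a.
  by move=> ab; rewrite /c /Num.min;
    case: ifP => ?; case: ifP => ?; apply/andP; split; lra.
have Ginc i a b : a <= b -> 0 <= G i b - G i a <= b - a.
  move=> ab; have /andP[c0 c1] := cinc _ _ ab; rewrite subr_ge0 in c0.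
  have cT : c b <= T + 1 by rewrite /c ge_min lexx orbT.
  have /andP[e0 e1] := expR_increment_le c0 cT; rewrite subr_ge0 in e0.
  have /andP[h0 h1] := Finc i _ _ e0.
  rewrite /G -mulrBr mulr_ge0 ?invr_ge0 ?expR_ge0//= mulrC ler_pdivrMr ?expR_gt0//.
  by rewrite (le_trans h1)// (le_trans e1)// mulrC ler_wpM2r ?expR_ge0.
have H : {ae (@lebesgue_measure R), forall t, forall i : 'I_n,
    t \in `]-1, T + 1[ -> derivable (G i) t 1}.
  apply: (@filter_forall_ord _ _ (ae_filter_ringOfSetsType lebesgue_measure) n
    (fun i t => t \in `]-1, T + 1[ -> derivable (G i) t 1)) => i.
  exact: monotone_lipschitz1_ae_derivable (Ginc i).
move: H; apply: filterS; first exact: (ae_filter_ringOfSetsType lebesgue_measure).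
move=> t /= Gt; rewrite in_itv/= => /andP[t0 tT]; apply/derivable_mxP => i j.
rewrite ord1; have {}Gt : derivable (G j) t 1.
  by apply: Gt; rewrite in_itv/=; apply/andP; split; lra.
apply: (@near_eq_derivable _ _ _ (expR (T + 1) \*: G j)); last exact: derivableZ.
near=> s.
have cs : c s = s.
  rewrite /c min_l// ltW//; near: s; apply: lt_nbhsl; lra.
by rewrite /G /= cs; apply: mulVKf; rewrite gt_eqF// expR_gt0.
Unshelve. all: by end_near. Qed.

(** A linear form on the simplex is a weighted average of its values at the vertices. *)
Lemma br_vertices {R : realType} n (v b : 'rV[R]_n) :
  simplex b -> (forall i, v 0 i <= dotp v b) -> br v b.
Proof.
move=> sb vb; split=> // x [x0 x1].
rewrite -[leRHS]mulr1 -x1 mulr_sumr; apply: ler_sum => i _.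
by rewrite ler_wpM2r.
Qed.

(** The product rule gives [z' = expR (- t) d - z], so the candidate response is [expR (- t) d]. It
    lies in the simplex because the coordinates of [F (expR s)] are nondecreasing with sum [expR s].
    It is optimal because the remaining error in [near_br] is quadratic in the increment. *)
Lemma log_time_derive_br {R : realType} m n (A : 'M[R]_(m, n))
    (G : R -> 'rV[R]_m) (F : R -> 'rV[R]_n) (C t : R) :
  cumulative_play F -> near_br A G F 0 C ->
  derivable (fun s => F (expR s)) t 1 ->
  let z s := expR (- s) *: F (expR s) in
  derivable z t 1 /\
  exists2 b, br ((expR (- t) *: G (expR t)) *m A) b & 'D_1 z t = b - z t.
Proof.
move=> Fp Fbr dF z; set d := 'D_1 (fun s => F (expR s)) t.
have [F0 Fn Fs] := Fp.
have Fd : is_derive t 1 (fun s => F (expR s)) d by apply/derivableP.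
have ed : is_derive t (1 : R) (fun s => expR (- s)) (- expR (- t)).
  rewrite -mulrN1; exact: (@is_derive1_comp _ expR -%R).
have zd i : is_derive t 1 (fun s => z s 0 i) (expR (- t) * d 0 i - z t 0 i).
  rewrite (_ : (fun s => _) = (fun s => expR (- s)) * (fun s => F (expR s) 0 i)).
    have := is_deriveM ed (is_derive_mxE 0 i Fd).
    rewrite /= scalerN [_ *: expR (- t)]mulrC /z mxE; exact.
  by apply/funext => s; rewrite /z mxE.
have dz : derivable z t 1.
  by apply/derivable_mxP => i j; rewrite ord1; apply: ex_derive; exact: zd.
split=> //; exists (expR (- t) *: d).
  have eF i : is_derive t 1 (fun s => F (expR s) 0 i) (d 0 i) by exact: is_derive_mxE.
  apply: br_vertices => [|i].
    split=> [i|].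
      rewrite mxE mulr_ge0 ?expR_ge0//; apply: derive_ge0_right (eF i) _ => s ts.
      by rewrite Fn// ler_expR.
    under eq_bigr do rewrite mxE.
    rewrite -mulr_sumr; have dS := is_derive_sumr eF.
    rewrite (_ : \sum_i d 0 i = expR t) ?expRxMexpNx_1 1?mulrC//; last first.
      rewrite -(@derive_val _ _ _ _ _ _ _ dS).
      rewrite (_ : (fun s => _) = expR) ?derive_val//.
      by apply/funext => s; rewrite Fs// expR_ge0.
    by rewrite expRN divff// gt_eqF// expR_gt0.
  set v := _ *m A; set a := expR t.
  have a0 : 0 < a by exact: expR_gt0.
  (* The inequality [near_br] says that [phi] is minimal at [t] among later times; the quadratic
     error [q] has zero derivative at [t]. *)
  pose q := (fun s => expR s - a) * (fun s => expR s - a).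
  pose phi := (fun s => dotp v (F (expR s)) - expR s * v 0 i) + (C / a) \*: q.
  have dphi : is_derive t 1 phi (dotp v d - a * v 0 i + (C / a) *: 0).
    apply: is_deriveD.
      apply: is_deriveB.
        apply: is_derive_sumr => j; exact: (@is_deriveZ _ _ _ (fun s => F (expR s) 0 j)).
      rewrite [a * _]mulrC (_ : (fun _ => _) = v 0 i \*: expR).
        exact: is_deriveZ.
      by apply/funext => s /=; rewrite mulrC.
    apply: is_deriveZ.
    have h : is_derive t 1 (fun s => expR s - a) (a - 0) by apply: is_deriveB.
    have := is_deriveM h h; rewrite /= subrr !scale0r addr0; exact.
  have phit s : t <= s -> phi t <= phi s.
    move=> ts; have as_ : a <= expR s by rewrite ler_expR.
    have := Fbr i _ _ a0 as_; rewrite -expRN -/v.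
    rewrite dotpDr dotpNr expRN -/a => H.
    rewrite /phi /q !fctE /= -/a !subrr /GRing.scale/=.
    have -> : C / a * ((expR s - a) * (expR s - a)) =
      (expR s - a) * (C * ((expR s - a) / a)) by ring.
    lra.
  have := derive_ge0_right dphi phit.
  rewrite scaler0 addr0 dotpZr subr_ge0 expRN => H.
  by rewrite mulrC ler_pdivlMr// mulrC.
rewrite derive_mx//; apply/rowP => i; rewrite !mxE.
by rewrite (@derive_val _ _ _ _ _ _ _ (zd i)) /z mxE.
Qed.

Lemma lipschitz_abs_cont_on {R : realType} (V : normedModType R) (T K : R)
    (f : R -> V) : 0 < K ->
  (forall a b, 0 <= a -> a <= b -> b <= T -> `|f b - f a| <= K * (b - a)) ->
  abs_cont_on 0 T f.
Proof.
move=> K0 fK e e0; exists (e / K); first by rewrite divr_gt0.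
move=> m s t st _; rewrite ltr_pdivlMr// => H; apply: le_lt_trans H.
rewrite mulrC mulr_sumr; apply: ler_sum => k _.
by have [s0 [ts tT]] := st k (ltn_ord k); exact: fK.
Qed.

(** This is the Lipschitz bound for averages between times [expR a] and [expR b], where
    [expR a >= 1]. *)
Lemma log_time_lipschitz {R : realType} n (F : R -> 'rV[R]_n) (T a b : R) :
  cumulative_play F -> 0 <= a -> a <= b -> b <= T ->
  `|expR (- b) *: F (expR b) - expR (- a) *: F (expR a)| <= expR T * (b - a).
Proof.
move=> Fp a0 ab bT; have eab : expR a <= expR b by rewrite ler_expR.
rewrite distrC !expRN (le_trans (average_lipschitz Fp (expR_gt0 a) eab))//.
have /andP[e0 e1] := expR_increment_le ab bT.
rewrite ler_pdivrMr ?expR_gt0// (le_trans e1)// ler_peMr ?(le_trans e0)//.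
by rewrite -expR0 ler_expR.
Qed.

Lemma is_derive_pair {R : realType} (V W : normedModType R) (f : R -> V)
    (g : R -> W) (t : R) (df : V) (dg : W) :
  is_derive t 1 f df -> is_derive t 1 g dg ->
  is_derive t 1 (fun s => (f s, g s)) (df, dg).
Proof.
move=> fd gd.
have fc := @ex_derive _ _ _ _ _ _ _ fd; have fE := @derive_val _ _ _ _ _ _ _ fd.
have gc := @ex_derive _ _ _ _ _ _ _ gd; have gE := @derive_val _ _ _ _ _ _ _ gd.
have H : h^-1 *: (((fun s => (f s, g s)) \o shift t) (h *: 1) - (f t, g t))
    @[h --> 0^'] --> (df, dg).
  rewrite -fE -gE; apply: (cvg_pair fc gc).
by apply: DeriveDef; [apply/cvg_ex; exists (df, dg) | exact: cvg_lim].
Qed.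

(** As matrix products, the payoff vectors of both players are covered by the same lemmas, with
    [U1^T] for player 1 and [U2] for player 2. *)
Lemma payv1E {R : realType} n1 n2 (U : 'M[R]_(n1, n2)) p :
  payv1 U p = p.2 *m U^T.
Proof.
by apply/rowP => a; rewrite !mxE; apply: eq_bigr => b _; rewrite mxE mulrC.
Qed.

Lemma payv2E {R : realType} n1 n2 (U : 'M[R]_(n1, n2)) p :
  payv2 U p = p.1 *m U.
Proof.
by apply/rowP => b; rewrite !mxE; apply: eq_bigr => a _; rewrite mulrC.
Qed.

Lemma log_time_br_solution {R : realType} n1 n2 (U1 U2 : 'M[R]_(n1, n2))
    (F1 : R -> 'rV[R]_n1) (F2 : R -> 'rV[R]_n2) (C1 C2 T : R) :
  cumulative_play F1 -> cumulative_play F2 ->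
  near_br U1^T F2 F1 0 C1 -> near_br U2 F1 F2 0 C2 ->
  br_solution U1 U2 T
    (fun s => (expR (- s) *: F1 (expR s), expR (- s) *: F2 (expR s))).
Proof.
move=> F1p F2p br1 br2; split.
  apply: (@lipschitz_abs_cont_on _ _ _ (expR T)); first exact: expR_gt0.
  by move=> a b a0 ab bT; rewrite prod_normE ge_max/= !log_time_lipschitz.
have d1 := log_time_ae_derivable T F1p; have d2 := log_time_ae_derivable T F2p.
move: d1 d2; apply: filterS2; first exact: (ae_filter_ringOfSetsType lebesgue_measure).
move=> t /= d1 d2 tT.
have [/derivableP dz1 [b1 brb1 E1]] := log_time_derive_br F1p br1 (d1 tT).
have [/derivableP dz2 [b2 brb2 E2]] := log_time_derive_br F2p br2 (d2 tT).
have dz := is_derive_pair dz1 dz2.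
have := @derive_val _ _ _ _ _ _ _ dz; have := @ex_derive _ _ _ _ _ _ _ dz.
move=> dzt ->; split=> //; rewrite payv1E payv2E.
by split; [exists b1|exists b2].
Qed.

(** Shadowing solutions live on one fixed horizon and are later cut to the length of a chain
    link. *)
Lemma br_solutionW {R : realType} n1 n2 (U1 U2 : 'M[R]_(n1, n2)) (S T : R) z :
  S <= T -> br_solution U1 U2 T z -> br_solution U1 U2 S z.
Proof.
move=> ST [zac zae]; split.
  move=> e /zac[d d0 H]; exists d => // m s t st; apply: H => k km.
  have [s0 [ts tT]] := st k km; split=> //; split=> //; exact: le_trans ST.
move: zae; apply: filterS; first exact: (ae_filter_ringOfSetsType lebesgue_measure).
move=> t H; rewrite in_itv/= => /andP[t0 tS]; apply: H.
by rewrite in_itv/= t0 (le_trans tS).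
Qed.

(** Convergence holds simultaneously on a finite grid of mesh [e / 2]. Between grid points both
    functions grow by an amount in [[0, e / 2]], so their difference changes by at most [e / 2]. *)
Lemma blowdown_uniform {R : realType} n (X F : R -> 'rV[R]_n)
    (U : set_system R) {FU : Filter U} (S e : R) :
  pinfty_nbhs R `<=` U -> cumulative_play X -> cumulative_play F ->
  (forall s i, t^-1 * X (s * t) 0 i @[t --> U] --> F s 0 i) -> 0 < e ->
  \forall t \near U, forall s, 0 <= s <= S -> `|t^-1 *: X (s * t) - F s| <= e.
Proof.
move=> Uoo Xp Fp XF e0; have Xinc := cumulative_play_incr Xp.
have Finc := cumulative_play_incr Fp; pose d := e / 2.
have d0 : 0 < d by rewrite divr_gt0.
have U0 : \forall t \near U, 0 < t by apply: Uoo; exact: nbhs_pinfty_gt.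
(* The successor admits the index [truncn (S / d)] of the last grid point below [S]. *)
pose N := (Num.truncn (S / d)).+1.
have grid : \forall t \near U, forall (k : 'I_N) (i : 'I_n),
    `|F (k%:R * d) 0 i - t^-1 * X (k%:R * d * t) 0 i| <= d.
  apply: filter_forall_ord => k; apply: filter_forall_ord => i.
  by have /cvgrPdist_le/(_ d d0) := XF (k%:R * d) i.
apply: filterS2 U0 grid => t t0 grid s /andP[s0 sS].
apply: norm_le_entry => [|i]; first exact: ltW.
have sd0 : 0 <= s / d by rewrite divr_ge0// ltW.
have /andP[k1 k2] := truncn_itv sd0; set k := Num.truncn (s / d) in k1 k2.
have kN : (k < N)%N.
  by rewrite ltnS /k; apply: le_truncn; rewrite ler_pM2r ?invr_gt0.
have := grid (Ordinal kN) i; rewrite /=; set u := k%:R * d => gr.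
have us : u <= s by rewrite -ler_pdivlMr.
have su : s - u <= d.
  move: k2; rewrite ltr_pdivrMr// -natr1 mulrDl mul1r -/u => /ltW; lra.
have /andP[f0 f1] := Finc i _ _ us.
have ut : u * t <= s * t by rewrite ler_pM2r.
have /andP[x0 x1] := Xinc i _ _ ut.
have y0 : 0 <= t^-1 * X (s * t) 0 i - t^-1 * X (u * t) 0 i.
  by rewrite -mulrBr mulr_ge0// invr_ge0 ltW.
have y1 : t^-1 * X (s * t) 0 i - t^-1 * X (u * t) 0 i <= s - u.
  by rewrite -mulrBr mulrC ler_pdivrMr// mulrBl.
rewrite !mxE; move: gr; rewrite !ler_norml => /andP[g1 g2].
have dE : e = 2 * d by rewrite /d; field.
by rewrite dE; apply/andP; split; lra.
Qed.

(** * Shadowing and chain transitivity *)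

Lemma omega_limit_closed {R : realType} (V : normedModType R) (f : R -> V) :
  closed (omega_limit f).
Proof.
move=> p pL T e e0; have e20 : 0 < e / 2 by rewrite divr_gt0.
have [q [Lq /= pq]] := pL _ (nbhsx_ballx p _ e20).
have [t [Tt ft]] := Lq T _ e20; exists t; split=> //.
rewrite -ball_normE /= in pq.
have -> : f t - p = (f t - q) + (q - p) by rewrite addrA subrK.
by rewrite (splitr e) (le_lt_trans (ler_normD _ _))// ltrD// distrC.
Qed.

Lemma simplex_compact {R : realType} n :
  exists2 K : set 'rV[R]_n, compact K & @simplex R n `<=` K.
Proof.
exists [set v : 'rV[R]_n | forall i, `[0, 1]%classic (v 0 i)].
  by apply: (@rV_compact R n (fun=> `[0, 1]%classic)) => i; exact: segment_compact.
move=> x [x0 x1] i; rewrite /= in_itv/= x0 -x1 (bigD1 i)//= lerDl.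
by rewrite sumr_ge0.
Qed.

Lemma average_simplex {R : realType} n (X : R -> 'rV[R]_n) (t : R) :
  cumulative_play X -> 0 < t -> simplex (t^-1 *: X t).
Proof.
move=> Xp t0; have [_ _ Xs] := Xp; have Xinc := cumulative_play_incr Xp.
split=> [i|].
  have := Xinc i 0 t (ltW t0); have [X0 _ _] := Xp; rewrite (X0 0 (lexx _)).
  by rewrite !mxE subr0 => /andP[x0 _]; rewrite mulr_ge0// invr_ge0 ltW.
under eq_bigr do rewrite mxE.
by rewrite -mulr_sumr Xs ?(ltW t0)// mulVf// gt_eqF.
Qed.

Lemma simplex_approx {R : realType} n (p : 'rV[R]_n) :
  (forall e : R, 0 < e -> exists2 q, simplex q & `|q - p| < e) -> simplex p.
Proof.
move=> pq; split=> [i|].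
  rewrite leNgt; apply/negP => p0.
  have [|q [q0 _] qp] := pq (- p 0 i); first by rewrite oppr_gt0.
  have := le_lt_trans (entry_le_norm (q - p) i) qp; rewrite !mxE.
  have := q0 i; have := ler_norm (q 0 i - p 0 i); lra.
apply/eqP; rewrite -subr_eq0 -normr_le0; apply/ler_addgt0Pr => e e0.
(* Dividing by [n + 1] rather than [n] also covers [n = 0]. *)
have n0 : (0 : R) < n%:R + 1 by rewrite ltr_wpDl.
have [|q [_ q1] qp] := pq (e / (n%:R + 1)); first by rewrite divr_gt0.
rewrite add0r -q1 -sumrB (le_trans (ler_norm_sum _ _ _))//.
apply: (@le_trans _ _ (\sum_(i < n) e / (n%:R + 1))).
  apply: ler_sum => i _; rewrite distrC.
  have := entry_le_norm (q - p) i; rewrite !mxE => h.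
  by rewrite (le_trans h)// ltW.
rewrite sumr_const card_ord -[leLHS]mulr_natr -mulrA ler_piMr ?(ltW e0)//.
by rewrite mulrC ler_pdivrMr// mul1r lerDl.
Qed.

Definition average_play {R : realType} n1 n2 (X1 : R -> 'rV[R]_n1)
    (X2 : R -> 'rV[R]_n2) (t : R) := (t^-1 *: X1 t, t^-1 *: X2 t).

Lemma omega_limit_average_simplex {R : realType} n1 n2 (X1 : R -> 'rV[R]_n1)
    (X2 : R -> 'rV[R]_n2) p : cumulative_play X1 -> cumulative_play X2 ->
  omega_limit (average_play X1 X2) p -> simplex p.1 /\ simplex p.2.
Proof.
move=> X1p X2p; set w := average_play X1 X2.
move=> Lp; split; apply: simplex_approx => e /(Lp 1)[t [t1 tp]].
  exists (w t).1; first by apply: average_simplex => //; exact: lt_le_trans t1.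
  by move: tp; rewrite prod_normE gt_max => /andP[].
exists (w t).2; first by apply: average_simplex => //; exact: lt_le_trans t1.
by move: tp; rewrite prod_normE gt_max => /andP[].
Qed.

Lemma omega_limit_average_compact {R : realType} n1 n2 (X1 : R -> 'rV[R]_n1)
    (X2 : R -> 'rV[R]_n2) : cumulative_play X1 -> cumulative_play X2 ->
  compact (omega_limit (average_play X1 X2)).
Proof.
move=> X1p X2p; set w := average_play X1 X2.
have [K1 K1c sK1] := @simplex_compact R n1.
have [K2 K2c sK2] := @simplex_compact R n2.
apply: (subclosed_compact (@omega_limit_closed _ _ w) (compact_setX K1c K2c)).
by move=> p /(omega_limit_average_simplex X1p X2p)[/sK1 ? /sK2].
Qed.

(** The argument [expR s * t] is logarithmic time started at [t], the clock in which average play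
    approximately follows the best response dynamics. *)
Definition shadows {R : realType} n1 n2 (U1 U2 : 'M[R]_(n1, n2))
    (w : R -> 'rV[R]_n1 * 'rV[R]_n2) (T e t : R) z :=
  [/\ br_solution U1 U2 T z, forall s, 0 <= s <= T -> omega_limit w (z s)
    & forall s, 0 <= s <= T -> `|z s - w (expR s * t)| <= e].

(** By contradiction: if unshadowed times are unbounded, some ultrafilter finer than [+oo] contains
    them. The blow-down along it is a solution close to the average play for almost all its times,
    hence for an unshadowed one. *)
Lemma eventually_shadowed {R : realType} n1 n2 (U1 U2 : 'M[R]_(n1, n2))
    (X1 : R -> 'rV[R]_n1) (X2 : R -> 'rV[R]_n2) (C1 D1 C2 D2 T e : R) :
  cumulative_play X1 -> cumulative_play X2 ->
  near_br U1^T X2 X1 C1 D1 -> near_br U2 X1 X2 C2 D2 -> 0 < e ->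
  exists t0 : R, forall t, t0 <= t ->
    exists z, shadows U1 U2 (average_play X1 X2) T e t z.
Proof.
move=> X1p X2p br1 br2 e0; set w := average_play X1 X2.
apply: contrapT => noz.
pose B : set R := [set t : R | ~ exists z, shadows U1 U2 w T e t z].
(* Failure of the claim puts a bad time beyond every bound, so the trace of [+oo] on [B] is a proper
   filter. *)
have FB : ProperFilter (within B (pinfty_nbhs R)).
  apply: Build_ProperFilter_ex => A [M [_ MA]]; apply: contrapT => nA.
  apply: noz; exists (M + 1) => t Mt; apply: contrapT => nz; apply: nA.
  by exists t; apply: (MA t _ nz); rewrite (lt_le_trans _ Mt)// ltrDl.
have [U [UU leFU]] := ultraFilterLemma FB; have PU := @ultra_proper _ _ UU.
have Uoo : pinfty_nbhs R `<=` U.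
  by move=> A AF; apply: leFU; apply: filterS AF.
have UB : U B.
  by apply: leFU; rewrite /within /=; apply: filterE => t.
have [F1 F1p XF1] := cumulative_play_blowdown UU Uoo X1p.
have [F2 F2p XF2] := cumulative_play_blowdown UU Uoo X2p.
have brF1 := near_br_blowdown UU Uoo XF1 XF2 br1.
have brF2 := near_br_blowdown UU Uoo XF2 XF1 br2.
pose z s := (expR (- s) *: F1 (expR s), expR (- s) *: F2 (expR s)).
have close S d : 0 < d -> \forall t \near U, forall s, 0 <= s <= S ->
    `|z s - w (expR s * t)| <= d.
  move=> d0.
  have H1 := blowdown_uniform (expR S) Uoo X1p F1p XF1 d0.
  have H2 := blowdown_uniform (expR S) Uoo X2p F2p XF2 d0.
  apply: filterS2 (H1 _) (H2 _) => t {}H1 {}H2 s /andP[s0 sS].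
  have es : 0 <= expR s <= expR S by rewrite expR_ge0 ler_expR.
  have es1 : `|expR (- s)| <= 1.
    by rewrite ger0_norm ?expR_ge0// -expR0 ler_expR oppr_le0.
  rewrite prod_normE ge_max /= invfM -expRN -!scalerA -!scalerBr !normrZ.
  rewrite ![`|F1 _ - _|]distrC ![`|F2 _ - _|]distrC.
  by rewrite -[d]mul1r !ler_pM ?H1 ?H2.
(* Closeness holds at arbitrarily large [t] and for arbitrarily small [d], which places [z s] in the
   limit set. *)
have zL s : 0 <= s -> omega_limit w (z s).
  move=> s0 M d d0; have d20 : 0 < d / 2 by rewrite divr_gt0.
  have tM : \forall t \near U, `|M| <= t.
    by apply: Uoo; apply: nbhs_pinfty_ge; exact: num_real.
  have [t [Mt H]] := filter_ex (filterI tM (close s _ d20)).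
  exists (expR s * t); split.
    rewrite (le_trans (ler_norm M))// (le_trans Mt)// ler_peMl ?(le_trans _ Mt)//.
    by rewrite -expR0 ler_expR.
  rewrite distrC (le_lt_trans (H s _)) ?s0 ?lexx//.
  by rewrite ltr_pdivrMr// ltr_pMr// ltr1n.
have [t [zt]] := filter_ex (filterI (close T e e0) UB); apply; exists z; split=> //.
  exact: log_time_br_solution brF1 brF2.
by move=> s /andP[s0 _]; exact: zL.
Qed.

(** The average play passes near [x] at some [ta] and near [z] at a much later [tb]. The logarithmic
    time between them is split into equal pieces, each shadowed by a solution in the limit set. At a
    junction both solutions are within [e / 2] of the same average. *)
Lemma omega_limit_average_ICT {R : realType} n1 n2 (U1 U2 : 'M[R]_(n1, n2))
    (X1 : R -> 'rV[R]_n1) (X2 : R -> 'rV[R]_n2) (C1 D1 C2 D2 : R) :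
  cumulative_play X1 -> cumulative_play X2 ->
  near_br U1^T X2 X1 C1 D1 -> near_br U2 X1 X2 C2 D2 ->
  ICT_br U1 U2 (omega_limit (average_play X1 X2)).
Proof.
move=> X1p X2p br1 br2; set w := average_play X1 X2.
split; first exact: omega_limit_average_compact.
split; first by move=> p; exact: omega_limit_average_simplex.
move=> x z Lx Lz e T e0 T0; have e20 : 0 < e / 2 by rewrite divr_gt0.
have [t0 ft0] := eventually_shadowed (T + T) X1p X2p br1 br2 e20.
(* The maximum with 1 keeps [ta] positive. *)
have [ta [ta0 xa]] := Lx (Num.max t0 1) _ e20.
move: ta0; rewrite ge_max => /andP[ta0 ta1].
have tap : 0 < ta by exact: lt_le_trans ta1.
have [tb [tb0 zb]] := Lz (expR T * ta) _ e20.
have tbp : 0 < tb by rewrite (lt_le_trans _ tb0)// mulr_gt0 ?expR_gt0.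
pose D := ln (tb / ta).
have TD : T <= D.
  rewrite -[T]expRK /D ler_ln ?posrE ?expR_gt0 ?divr_gt0//.
  by rewrite ler_pdivlMr.
have DT0 : 0 <= D / T by rewrite divr_ge0 ?(ltW T0)// (le_trans (ltW T0)).
(* Since [T <= D], [m >= 1]; from [m T <= D < (m + 1) T <= 2 m T] the piece length [D / m] lies
   between [T] and [T + T]. *)
pose m := Num.truncn (D / T); have /andP[m1 m2] := truncn_itv DT0.
have m0 : (0 < m)%N by rewrite truncn_gt0 ler_pdivlMr// mul1r.
have m0R : (0 : R) < m%:R by rewrite ltr0n.
pose l := D / m%:R.
have Tl : T <= l by rewrite ler_pdivlMr// mulrC -ler_pdivlMr.
have lT : l <= T + T.
  rewrite ler_pdivrMr//; move: m2; rewrite ltr_pdivrMr// => /ltW h.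
  rewrite (le_trans h)// mulrC mulrDl -mulrDr ler_wpM2l ?(ltW T0)//.
  by rewrite -natrD ler_nat -/m -addn1 leq_add2l.
have l0 : 0 <= l by rewrite (le_trans _ Tl)// ltW.
pose t (i : nat) := expR (i%:R * l) * ta.
have tS i : expR l * t i = t i.+1.
  by rewrite /t mulrA -expRD -natr1 mulrDl mul1r addrC.
have tge i : t0 <= t i.
  rewrite (le_trans ta0)// ler_peMl ?(ltW tap)//.
  by rewrite -expR0 ler_expR mulr_ge0.
have tm : t m = tb.
  have -> : t m = expR D * ta by rewrite /t /l [m%:R * _]mulrC divfK ?gt_eqF.
  by rewrite lnK ?posrE ?divr_gt0// divfK// gt_eqF.
have [zs zsP] := choice (fun i => ft0 _ (tge i)).
have zs0 i : `|zs i 0 - w (t i)| <= e / 2.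
  have [_ _ /(_ 0)] := zsP i; rewrite expR0 mul1r; apply.
  by rewrite lexx addr_ge0 ?ltW.
have zsl i : `|zs i l - w (t i.+1)| <= e / 2.
  by have [_ _ /(_ l)] := zsP i; rewrite tS; apply; rewrite l0.
have tri (a b c : 'rV[R]_n1 * 'rV[R]_n2) :
    `|a - c| <= e / 2 -> `|b - c| <= e / 2 -> `|a - b| <= e.
  move=> ac bc; rewrite (splitr e) -(subrK c a) -addrA.
  by rewrite (le_trans (ler_normD _ _))// lerD// distrC.
exists m, zs, (fun=> l); split=> //; split=> [i im|].
  have [zi Li _] := zsP i; split=> //; split; first exact: br_solutionW lT zi.
  by move=> s /andP[s0 sl]; apply: Li; rewrite s0 (le_trans sl).
split=> [i im|]; first exact: tri (zsl i) (zs0 i.+1).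
split.
  apply: (tri _ _ (w (t 0%N)) (zs0 0%N)).
  by rewrite /t mulr0n mul0r expR0 mul1r distrC ltW.
apply: (tri _ _ (w (t m)) _ _); last by rewrite tm distrC ltW.
by have := zsl m.-1; rewrite prednK.
Qed.

(** * From the score dynamics to cumulative play *)

(** The Lipschitz choice map makes play continuous at positive times, so the integral is
    differentiable there. The coordinate sum minus [t] then has zero derivative and tends to 0 at
    [0^'+]. *)
Lemma choice_play_cumulative {R : realType} n (h : 'rV[R]_n -> R) Q
    (y : R -> 'rV[R]_n) : penalty h -> choice_map h Q ->
  (forall t : R, 0 < t -> derivable y t 1) ->
  let X t := \row_i \int[@lebesgue_measure R]_(s in `[0, t]) Q (y s) 0 i in
  cumulative_play X /\
  forall j (t : R), 0 < t -> is_derive t 1 (fun s => X s 0 j) (Q (y t) 0 j).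
Proof.
move=> hpen hQ dy X; have [c Qc] := choice_map_lipschitz hpen hQ.
have sQ s := (hQ (y s)).1.
have Q01 i s : 0 <= Q (y s) 0 i <= 1.
  have [x0 x1] := sQ s; rewrite x0 -x1 (bigD1 i)//= lerDl.
  by rewrite sumr_ge0.
have Qcont i (s : R) : 0 < s -> {for s, continuous (fun s => Q (y s) 0 i)}.
  move=> s0; have /cvgrPdist_le yc : {for s, continuous y}.
    by apply: differentiable_continuous; apply/derivable1_diffP; exact: dy.
  apply/cvgrPdist_le => e e0.
  have c0 : 0 < `|c| + 1 by rewrite ltr_wpDl.
  have ec : 0 < e / (`|c| + 1) by rewrite divr_gt0.
  apply: filterS (yc _ ec) => t yst.
  have := entry_le_norm (Q (y s) - Q (y t)) i; rewrite !mxE => H.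
  rewrite (le_trans H)// (le_trans (Qc _ _))//.
  rewrite (le_trans (ler_wpM2r (normr_ge0 _) (ler_norm c)))//.
  move: yst; rewrite ler_pdivlMr// mulrC; apply: le_trans.
  by rewrite ler_wpM2r// lerDl.
have P i := primitive_monotone (Q01 i) (Qcont i).
have XE i t : X t 0 i = \int[@lebesgue_measure R]_(s in `[0, t]) Q (y s) 0 i.
  by rewrite mxE.
have X' j (t : R) : 0 < t -> is_derive t 1 (fun s => X s 0 j) (Q (y t) 0 j).
  move=> t0; rewrite (_ : (fun s => _) = fun t =>
    \int[@lebesgue_measure R]_(s in `[0, t]) Q (y s) 0 j).
    by have [_ _] := P j; exact.
  by apply/funext => s; rewrite XE.
have X0 (t : R) : t <= 0 -> X t = 0.
  by move=> t0; apply/rowP => i; rewrite XE [RHS]mxE; have [X0 _ _] := P i; exact: X0.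
have Xinc i (a b : R) : a <= b -> 0 <= X b 0 i - X a 0 i <= b - a.
  by move=> ab; rewrite !XE; have [_ H _] := P i; exact: H.
split=> //; split=> // [i a b ab|t].
  by have := Xinc i _ _ ab; rewrite subr_ge0 => /andP[].
rewrite le_eqVlt => /predU1P[<-|t0].
  by rewrite X0// big1// => i _; rewrite mxE.
suff H : \sum_i X t 0 i - t = 0 by apply/eqP; rewrite -subr_eq0 H.
apply: (@derive0_cst_right _ (fun t => \sum_i X t 0 i - t)) => //.
  move=> s s0; have [_ Q1] := sQ s.
  have := is_derive_sumr (fun j => X' j s s0); rewrite Q1 => dS.
  have := is_deriveB dS (is_derive_id s (1 : R)); rewrite subrr; exact.
rewrite -[X in _ --> X](subrr (0 : R)); apply: cvgB.
  have : \sum_i X t 0 i @[t --> 0^'+] --> \sum_(i < n) (0 : R).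
    apply: cvg_sumr => i; apply: cvg_at_right_filter.
    have X00 : X 0 0 i = 0 by rewrite X0// mxE.
    by rewrite -[Z in _ --> Z]X00; apply: monotone_continuous1; exact: Xinc.
  by rewrite big1_eq.
exact: cvg_at_right_filter cvg_id.
Qed.

Theorem theorem6p3 (R : realType) (n1 n2 : nat) (U1 U2 : 'M[R]_(n1, n2))
  (h1 : 'rV[R]_n1 -> R) (h2 : 'rV[R]_n2 -> R)
  (Q1 : 'rV[R]_n1 -> 'rV[R]_n1) (Q2 : 'rV[R]_n2 -> 'rV[R]_n2)
  (y1 : R -> 'rV[R]_n1) (y2 : R -> 'rV[R]_n2) :
  penalty h1 -> penalty h2 ->
  choice_map h1 Q1 -> choice_map h2 Q2 ->
  (forall t : R, 0 < t ->
     is_derive t 1 y1 (payv1 U1 (Q1 (y1 t), Q2 (y2 t))) /\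
     is_derive t 1 y2 (payv2 U2 (Q1 (y1 t), Q2 (y2 t)))) ->
  y1 @ 0^'+ --> y1 0 -> y2 @ 0^'+ --> y2 0 ->
  ICT_br U1 U2
    (omega_limit (fun t => (time_avg (fun s => Q1 (y1 s)) t,
                            time_avg (fun s => Q2 (y2 s)) t))).
Proof.
move=> pen1 pen2 ch1 ch2 dy y1c y2c.
have dy1 (t : R) : 0 < t -> is_derive t 1 y1 (Q2 (y2 t) *m U1^T).
  by move=> /dy[+ _]; rewrite payv1E.
have dy2 (t : R) : 0 < t -> is_derive t 1 y2 (Q1 (y1 t) *m U2).
  by move=> /dy[_]; rewrite payv2E.
have [|X1p X1'] := @choice_play_cumulative _ _ _ _ y1 pen1 ch1.
  by move=> t /dy1 ?; exact: ex_derive.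
have [|X2p X2'] := @choice_play_cumulative _ _ _ _ y2 pen2 ch2.
  by move=> t /dy2 ?; exact: ex_derive.
(* Each player's score is its initial value plus the payoff of the opponent's cumulative play. *)
have y1E := payoff_primitive X2p X2' dy1 y1c.
have y2E := payoff_primitive X1p X1' dy2 y2c.
have [K1 K10 gap1] := choice_map_gap ch1.
have [K2 K20 gap2] := choice_map_gap ch2.
have [C1 _ br1] := near_br_play X2p (fun t => (ch1 (y1 t)).1) X1' y1E K10
  (fun t => gap1 (y1 t)).
have [C2 _ br2] := near_br_play X1p (fun t => (ch2 (y2 t)).1) X2' y2E K20
  (fun t => gap2 (y2 t)).
have := omega_limit_average_ICT X1p X2p br1 br2.
congr (ICT_br _ _ (omega_limit _)); apply/funext => t.
by congr pair; apply/rowP => i; rewrite !mxE.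
Qed.
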